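(* Let $0<p<\infty$. Then there is a positive real number $C_p$, depending only on $p$, such that $$\sigma_0^{p,\infty}(\varrho_p)\le C_p\left[\frac{\log(n+1)}{n}\right]^{1/p}$$ for all integers $n\ge2$.
   Context: Let $\mathbb{R}_+=[0,\infty)$ and $\Delta_p^n=\{t\in\mathbb{R}_+^n:\sum_{j=1}^n t_j^p=1\}$. Let $\mathcal{H}$ be the $(n-1)$-dimensional Hausdorff measure in $\mathbb{R}^n$. The normalized surface measure on $\Delta_p^n$ is $\varrho_p(\mathcal{A})=\mathcal{H}(\mathcal{A})/\mathcal{H}(\Delta_p^n)$, $\mathcal{A}\subset\Delta_p^n$. The best $m$-term approximation error is $\sigma_m(x)_q=\inf\{\|x-y\|_q:y\in\mathbb{R}^n\text{ has at most }m\text{ nonzero coordinates}\}$, with $\|\cdot\|_q$ the usual $\ell_q$ (quasi-)norm (maximum of absolute values for $q=\infty$), and for a Borel probability measure $\mu$ on $\Delta_p^n$ one sets $\sigma_m^{p,q}(\mu)=\int_{\Delta_p^n}\sigma_m(x)_q\,d\mu(x)$. Thus $\sigma_0^{p,\infty}(\varrho_p)=\int_{\Delta_p^n}\max_j x_j\,d\varrho_p(x)$. *)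

(* Defs.v *)
From HB Require Import structures.
From mathcomp Require Import all_boot all_order all_algebra.
From mathcomp Require Import all_classical all_reals all_analysis.

Set Implicit Arguments.
Unset Strict Implicit.
Unset Printing Implicit Defensive.

Import Order.TTheory GRing.Theory Num.Theory.
Import numFieldNormedType.Exports.

Local Open Scope classical_set_scope.
Local Open Scope ring_scope.

(** Intended for [0 < q <= +oo]; the value at [-oo] is junk. *)
Definition lq_norm (R : realType) (n : nat) (q : \bar R) (x : 'rV[R]_n) : R :=
  match q with
  | q'%:E => (\sum_(i < n) `|x 0 i| `^ q') `^ q'^-1
  | +oo%E => \big[Num.max/0]_(i < n) `|x 0 i|
  | -oo%E => 0
  end.

(** The library's norm on ['rV[R]_n] is the maximum norm, hence the explicit
    Euclidean distance here. The union with [[set 0]] sets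
    [ediam set0 = 0] and has no effect on nonempty sets. *)
Definition ediam (R : realType) (n : nat) (U : set 'rV[R]_n) : \bar R :=
  ereal_sup ([set 0%E] `|`
    [set (lq_norm 2%:E (xy.1 - xy.2))%:E | xy in U `*` U]).

(** The case distinction only matters for [s = 0], where [0 `^ 0 = 1]. *)
Definition hausdorff_gauge (R : realType) (n : nat) (s : R)
    (U : set 'rV[R]_n) : \bar R :=
  if U == set0 then 0%E else (ediam U `^ s)%E.

Definition hausdorff_content (R : realType) (n : nat) (s delta : R)
    (A : set 'rV[R]_n) : \bar R :=
  ereal_inf [set (\sum_(0 <= i <oo) hausdorff_gauge s (U i))%E |
    U in [set U : (set 'rV[R]_n)^nat |
      A `<=` \bigcup_i U i /\ forall i, (ediam (U i) <= delta%:E)%E]].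

(** The [s]-dimensional Hausdorff (outer) measure for the Euclidean distance,
    without the constant (depending on [s] only) that makes it agree with
    Lebesgue measure when [s = n]: it is used only through the quotient in
    [surface_measure], where any such constant cancels. *)
Definition hausdorff (R : realType) (n : nat) (s : R)
    (A : set 'rV[R]_n) : \bar R :=
  ereal_sup [set hausdorff_content s delta A | delta in [set d : R | 0 < d]].

Definition pos_lp_sphere (R : realType) (n : nat) (p : R) : set 'rV[R]_n :=
  [set t | (forall j, 0 <= t 0 j) /\ \sum_(j < n) t 0 j `^ p = 1].
Arguments pos_lp_sphere {R} n p _.

(** [R^n] with its Borel sigma-algebra. *)
Definition borel_rV (R : realType) (n : nat) :=
  g_sigma_algebraType (@open 'rV[R]_n).

(** The normalized surface measure of [pos_lp_sphere n p], extended by zero to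
    [R^n]; it is a probability measure on the Borel sets for [n >= 2]. *)
Definition surface_measure (R : realType) (n : nat) (p : R)
    (A : set (borel_rV R n)) : \bar R :=
  (hausdorff n.-1%:R (A `&` pos_lp_sphere n p) /
   hausdorff n.-1%:R (pos_lp_sphere n p))%E.
Arguments surface_measure {R} n p _.

Definition best_approx_error (R : realType) (n m : nat) (q : \bar R)
    (x : 'rV[R]_n) : R :=
  inf [set lq_norm q (x - y) |
    y in [set y : 'rV[R]_n | (#|[pred i | (y 0 i != 0)%R]| <= m)%N]].

(** The library's integral takes a bare set function [mu], here on the Borel
    sets of [R^n]; a Borel measure on [pos_lp_sphere n p] is represented by its
    extension by zero, as in [surface_measure]. *)
Definition avg_best_approx_error (R : realType) (n m : nat) (p : R)
    (q : \bar R) (mu : set (borel_rV R n) -> \bar R) : \bar R :=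
  (\int[mu]_(x in pos_lp_sphere n p) (best_approx_error m q x)%:E)%E.

(* Main.v *)
From HB Require Import structures.
Require Import Defs.
From mathcomp Require Import all_boot all_order all_algebra.
From mathcomp Require Import all_classical all_reals all_analysis.
From mathcomp Require Import measurable_realfun ring lra.

Import Order.TTheory GRing.Theory Num.Theory.
Import numFieldNormedType.Exports.

(** Fix a coordinate [i] and [0 < tau < 1]. The map sending [x_i] to
    [(tau + (1 - tau) x_i^p)^(1/p)] and multiplying the other coordinates by
    [(1 - tau)^(1/p)] preserves the sphere [sum_j x_j^p = 1], and the image of
    its part [x_i^p >= tau] contains its part [x_i^p >= 2 tau]. It contracts
    distances by [(1 - tau)^(1/p)] except along the [i]-th coordinate, where it
    is Lipschitz with a constant polynomial in [n] as soon as [tau >= 1/n]. Since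
    one bad direction costs only a factor polynomial in [n] in the Hausdorff
    measure, [x_i^p >= 2 tau] has normalized measure at most
    [poly(n) (1 - tau)^((n-1)/p)]. Taking [tau = K ln(n+1)/n] with [K] large and
    summing over [i], the maximum exceeds [(2 tau)^(1/p)] with probability
    [O(n^(-1/p))], and it never exceeds [1]. *)

Local Open Scope classical_set_scope.
Local Open Scope ring_scope.

(** * Hausdorff outer measure *)

Section euclidean.
Context {R : realType} {n : nat}.
Implicit Types (x y : 'rV[R]_n) (U V : set 'rV[R]_n).

Lemma lq_norm_ge0 (q : \bar R) x : 0 <= lq_norm q x.
Proof.
case: q => [q||] //=; first exact: powR_ge0.
by elim/big_rec: _ => // i r _ r0; rewrite le_max r0 orbT.
Qed.

Lemma lq_norm2_sqr x : lq_norm 2%:E x ^+ 2 = \sum_(i < n) x 0 i ^+ 2.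
Proof.
rewrite /= powR12_sqrt; last by apply: sumr_ge0 => i _; exact: powR_ge0.
rewrite sqr_sqrtr; last by apply: sumr_ge0 => i _; exact: powR_ge0.
by apply: eq_bigr => i _; rewrite powR_mulrn// real_normK// num_real.
Qed.

Lemma coord_le_lq_norm2 x i : `|x 0 i| <= lq_norm 2%:E x.
Proof.
rewrite -(ler_pXn2r (ltn0Sn 1)) ?nnegrE ?lq_norm_ge0//.
rewrite lq_norm2_sqr real_normK ?num_real// (bigD1 i)//= lerDl.
by apply: sumr_ge0 => j _; exact: sqr_ge0.
Qed.

Lemma le_ediam U x y : U x -> U y -> ((lq_norm 2%:E (x - y))%:E <= ediam U)%E.
Proof. by move=> Ux Uy; apply: ereal_sup_ubound; right; exists (x, y). Qed.

Lemma ediam_ge0 U : (0 <= ediam U)%E.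
Proof. by apply: ereal_sup_ubound; left. Qed.

Lemma ediam_le U (d : R) : 0 <= d ->
  (forall x y, U x -> U y -> lq_norm 2%:E (x - y) <= d) ->
  (ediam U <= d%:E)%E.
Proof.
move=> d0 Ud; apply: ge_ereal_sup => _ [->|[[x y] [/= Ux Uy] <-]].
  by rewrite lee_fin.
by rewrite lee_fin; exact: Ud.
Qed.

Lemma ediam_subset U V : U `<=` V -> (ediam U <= ediam V)%E.
Proof.
move=> UV; apply: ge_ereal_sup => _ [->|[[x y] [/= Ux Uy] <-]].
  exact: ediam_ge0.
by apply: le_ediam; exact: UV.
Qed.

Lemma gauge0 (s : R) : @hausdorff_gauge R n s set0 = 0%E.
Proof. by rewrite /hausdorff_gauge eqxx. Qed.

Lemma gauge_ge0 (s : R) U : (0 <= hausdorff_gauge s U)%E.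
Proof. by rewrite /hausdorff_gauge; case: ifP => // _; exact: poweR_ge0. Qed.

Lemma gauge_subset (s : R) U V : 0 <= s -> U `<=` V ->
  (hausdorff_gauge s U <= hausdorff_gauge s V)%E.
Proof.
move=> s0 UV; rewrite /hausdorff_gauge; case: ifPn => [_|/set0P[x Ux]].
  by case: ifP => // _; exact: poweR_ge0.
rewrite ifF; last by apply/eqP => V0; have := UV x Ux; rewrite V0.
by apply: gt0_ler_poweR => //; rewrite ?in_itv/= ?ediam_ge0 ?leey//; exact: ediam_subset.
Qed.

End euclidean.

Section hausdorff_outer_measure.
Context {R : realType} {n : nat}.
Variable s : R.
Hypothesis s0 : 0 <= s.
Implicit Types (A B U : set 'rV[R]_n) (d e : R).
Local Open Scope ereal_scope.

Let allsets := g_sigma_algebraType [set: set 'rV[R]_n].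

Let capped d (U : set allsets) : \bar R :=
  if ediam U <= d%:E then hausdorff_gauge s U else +oo.

Let capped_ge0 d U : 0 <= capped d U.
Proof. by rewrite /capped; case: ifP => // _; exact: gauge_ge0. Qed.

(* Covers by small sets are covers by arbitrary sets for the gauge capped at
   [+oo], which puts the library's [mu_ext] within reach. *)
Let contentE d : hausdorff_content s d = mu_ext (capped d).
Proof.
apply/funext => A; apply/eqP; rewrite eq_le; apply/andP; split.
- apply: le_ereal_inf_tmp => _ [U [mU AU] <-].
  have [Ud|] := pselect (forall i, ediam (U i) <= d%:E).
    apply: ereal_inf_lbound; exists U => //.
    by apply: eq_eseriesr => i _; rewrite /capped Ud.
  (* One set of the cover is too large, so the capped sum is [+oo] and bounds anything. *)
  move=> /existsNP[i /negP Ui]; rewrite (@eseries_pinfty _ _ _ i) ?leey//.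
    by move=> k _; rewrite -ltNye (lt_le_trans _ (capped_ge0 _ _)).
  by rewrite /capped (negbTE Ui).
- apply: le_ereal_inf_tmp => _ [U [AU Ud] <-].
  apply: ereal_inf_lbound; exists U.
    by split=> // i; exact: sub_sigma_algebra.
  by apply: eq_eseriesr => i _; rewrite /capped Ud.
Qed.

Lemma content_ge0 d A : 0 <= hausdorff_content s d A.
Proof. by rewrite contentE; exact: mu_ext_ge0. Qed.

Lemma content_subset d A B : A `<=` B ->
  hausdorff_content s d A <= hausdorff_content s d B.
Proof. by move=> AB; rewrite contentE; exact: le_mu_ext. Qed.

Lemma content0 d : (0 <= d)%R -> @hausdorff_content R n s d set0 = 0.
Proof.
move=> d0; rewrite contentE mu_ext0// /capped.
by rewrite gauge0 ediam_le// => x y [].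
Qed.

Lemma content_sigma_subadditive d :
  sigma_subadditive (@hausdorff_content R n s d).
Proof. by rewrite contentE; apply: (@mu_ext_sigma_subadditive _ allsets _ (capped d)). Qed.

Lemma content_le_gauge d A : (0 <= d)%R -> ediam A <= d%:E ->
  hausdorff_content s d A <= hausdorff_gauge s A.
Proof.
move=> d0 Ad; apply: ereal_inf_lbound.
exists (fun i => if i == 0%N then A else set0).
  split=> [x Ax|[|i]//]; first by exists 0%N.
  by apply: ediam_le => // x y [].
rewrite nneseries_recl//; last by move=> k _; exact: gauge_ge0.
by rewrite eseries_cond eseries0 ?adde0// => -[|k] //= _ _; exact: gauge0.
Qed.

Lemma content_antitone A d e : (d <= e)%R ->
  hausdorff_content s e A <= hausdorff_content s d A.
Proof.
move=> de; apply: le_ereal_inf_tmp => _ [U [AU Ud] <-].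
apply: ereal_inf_lbound; exists U => //; split=> // i.
by rewrite (le_trans (Ud i)).
Qed.

Lemma content_le_hausdorff d A : (0 < d)%R ->
  hausdorff_content s d A <= hausdorff s A.
Proof. by move=> d0; apply: ereal_sup_ubound; exists d. Qed.

Lemma hausdorff_ge0 A : 0 <= hausdorff s A.
Proof.
apply: le_trans (content_ge0 1%R A) _.
by apply: content_le_hausdorff; rewrite ltr01.
Qed.

Lemma hausdorff0 : @hausdorff R n s set0 = 0.
Proof.
apply/eqP; rewrite eq_le hausdorff_ge0 andbT.
by apply: ge_ereal_sup => _ [d /= d0 <-]; rewrite content0// ltW.
Qed.

Lemma hausdorff_subset A B : A `<=` B -> hausdorff s A <= hausdorff s B.
Proof.
move=> AB; apply: ge_ereal_sup => _ [d /= d0 <-].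
by apply: le_trans (@content_subset d _ _ AB) _; exact: content_le_hausdorff.
Qed.

Lemma hausdorff_sigma_subadditive : sigma_subadditive (@hausdorff R n s).
Proof.
move=> F; apply: ge_ereal_sup => _ [d /= d0 <-].
apply: le_trans (content_sigma_subadditive d F) _.
apply: lee_nneseries => [i _ _|i _]; first exact: content_ge0.
exact: content_le_hausdorff.
Qed.

(** A set of diameter at most [d] cannot meet both [A] and [B]. Intersecting a cover of the union
    with [A] and with [B] therefore splits its gauge sum in two without increasing it. *)
Lemma content_separated A B d :
  (forall x y, A x -> B y -> (d < lq_norm 2%:E (x - y))%R) ->
  hausdorff_content s d A + hausdorff_content s d B <=
  hausdorff_content s d (A `|` B).
Proof.
move=> AB; apply: le_ereal_inf_tmp => _ [U [ABU Ud] <-].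
have part C : C `<=` A `|` B -> hausdorff_content s d C <=
    \sum_(0 <= i <oo) hausdorff_gauge s (U i `&` C).
  move=> CAB; apply: ereal_inf_lbound; exists (fun i => U i `&` C) => //.
  split=> [x Cx|i]; first by have [i _ Ui] := ABU x (CAB x Cx); exists i.
  by apply: le_trans (Ud i); apply: ediam_subset => x [].
apply: le_trans (leeD (part A _) (part B _)) _ => //.
rewrite -nneseriesD; [|by move=> *; exact: gauge_ge0..].
apply: lee_nneseries => i _ => [_|]; first by rewrite adde_ge0 ?gauge_ge0.
have [->|/set0P[x [Ux Ax]]] := eqVneq (U i `&` A) set0.
  by rewrite gauge0 add0e gauge_subset// => x [].
suff -> : U i `&` B = set0 by rewrite gauge0 adde0 gauge_subset// => z [].
apply/seteqP; split=> // y [Uy By].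
have := le_trans (le_ediam _ _ _ Ux Uy) (Ud i).
by rewrite lee_fin leNgt AB.
Qed.

Lemma hausdorff_separated A B d : (0 < d)%R ->
  (forall x y, A x -> B y -> (d <= lq_norm 2%:E (x - y))%R) ->
  hausdorff s A + hausdorff s B <= hausdorff s (A `|` B).
Proof.
move=> d0 AB.
have [->|fin] := eqVneq (hausdorff s (A `|` B)) +oo; first by rewrite leey.
have fin' C : C `<=` A `|` B -> hausdorff s C \is a fin_num.
  move=> CAB; rewrite ge0_fin_numE ?hausdorff_ge0//.
  by apply: le_lt_trans (hausdorff_subset _ _ CAB) _; rewrite ltey.
have finA : hausdorff s A \is a fin_num by apply: fin' => x; left.
have finB : hausdorff s B \is a fin_num by apply: fin' => x; right.
(* The two suprema are bounded one after the other, the other term being subtracted meanwhile; this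
   is why finiteness was secured first. *)
rewrite -leeBrDr//; apply: ge_ereal_sup => _ [a /= a0 <-].
have finAa : hausdorff_content s a A \is a fin_num.
  rewrite ge0_fin_numE ?content_ge0//.
  by apply: le_lt_trans (@content_le_hausdorff _ _ a0) _; rewrite -ge0_fin_numE ?hausdorff_ge0.
rewrite leeBrDr// addeC -leeBrDr//; apply: ge_ereal_sup => _ [b /= b0 <-].
(* [d / 2] provides the strict gap of [content_separated]; [a] and [b] enter because the content
   grows as the scale shrinks. *)
rewrite leeBrDr//; pose c := Num.min (d / 2)%R (Num.min a b).
have c0 : (0 < c)%R by rewrite !lt_min a0 b0 !andbT divr_gt0.
have cd : (c < d)%R by rewrite gt_min; apply/orP; left; lra.
rewrite addeC; apply: le_trans (content_le_hausdorff c _ c0).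
apply: le_trans (content_separated _ _ c _); last first.
  by move=> x y Ax By; exact: lt_le_trans cd (AB _ _ Ax By).
by apply: leeD; apply: content_antitone; rewrite !ge_min lexx ?orbT.
Qed.

End hausdorff_outer_measure.

(** * Borel sets are measurable *)

Section caratheodory_criterion.
Context {R : realType} {T : Type}.
Variable mu : {outer_measure set T -> \bar R}.
Local Open Scope ereal_scope.

(* The heart of Caratheodory's criterion: the layers of [E] between [F k] and
   [F k.+1] have summable measures because every other one is separated. *)
Lemma caratheodory_measurable_exhaustion (F : (set T)^nat) :
  (forall k, F k `<=` F k.+1) ->
  (forall k A B, A `<=` F k -> B `<=` ~` F k.+1 ->
    mu A + mu B <= mu (A `|` B)) ->
  mu.-caratheodory (\bigcup_k F k).
Proof.
move=> ndF sepF; apply: le_caratheodory_measurable => E.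
have [->|Efin] := eqVneq (mu E) +oo; first by rewrite leey.
have subE A : A `<=` E -> mu A <= mu E by exact: le_outer_measure.
pose D j := E `&` (F j.+2 `\` F j.+1).
(* In the induction, [D m] avoids [F m.+1] and is thus separated from [E] inside [F m]; together
   they fit in [E] inside [F m.+2]. *)
have sumD m : \sum_(0 <= j < m) mu (D j) <= mu (E `&` F m) + mu (E `&` F m.+1).
  elim: m => [|m IH]; first by rewrite big_nil adde_ge0// outer_measure_ge0.
  rewrite big_nat_recr//=; apply: le_trans (leeD2r _ IH) _.
  rewrite -addeA addeC -addeA leeD2l// addeC.
  apply: le_trans (sepF m _ _ _ _) _; [by move=> x []|by move=> x [_ []]|].
  by apply: le_outer_measure => x [[Ex /ndF/ndF]|[Ex []]].
have sumDoo : \sum_(0 <= j <oo) mu (D j) < +oo.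
  apply: (@le_lt_trans _ _ (mu E + mu E)); last by rewrite lte_add_pinfty ?ltey.
  apply: lime_le; first by apply: is_cvg_nneseries => *; exact: outer_measure_ge0.
  apply: nearW => m; apply: le_trans (sumD m) _.
  by apply: leeD; apply: subE => x [].
have FE k : mu (E `&` \bigcup_k F k) + mu (E `&` ~` \bigcup_k F k) <=
    mu E + \sum_(k <= j <oo) mu (D j).
  (* A point outside [F k.+1] enters the exhaustion at a first index [m.+1] with [k < m], hence lies
     in the layer [D m.-1]. *)
  have FD : E `&` \bigcup_k F k `<=` (E `&` F k.+1) `|` \bigcup_(j in ~` `I_k) D j.
    move=> x [Ex [m _ Fx]].
    have [Fk|nFk] := pselect (F k.+1 x); [by left|right].
    elim: m Fx => [|m IH] Fx.
      by exfalso; apply: nFk; elim: k.+1 => // j; exact: ndF.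
    have [/IH//|nFm] := pselect (F m x).
    have km : (k.+1 <= m)%N.
      rewrite leqNgt; apply/negP => mk; apply: nFk.
      have -> : k.+1 = (m.+1 + (k.+1 - m.+1))%N by rewrite subnKC.
      by elim: (_ - _)%N => [|j]; rewrite ?addn0// addnS; exact: ndF.
    exists m.-1; first by apply/negP; rewrite -leqNgt -ltnS prednK// (leq_trans _ km).
    by rewrite /D prednK// (leq_trans _ km).
  apply: (@le_trans _ _ (mu (E `&` F k.+1) + \sum_(k <= j <oo) mu (D j) +
                         mu (E `&` ~` \bigcup_k F k))).
    rewrite leeD2r//; apply: le_trans (le_outer_measure mu _ _ FD) _.
    apply: le_trans (outer_measureU2 _ _ _) _; rewrite leeD2l//.
    exact: outer_measure_sigma_subadditive_tail.
  rewrite addeAC leeD2r//; apply: le_trans (sepF k.+1 _ _ _ _) _.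
  - by move=> x [].
  - by move=> x [_ nF] Fx; apply: nF; exists k.+2.
  - by apply: subE => x [[]|[]].
apply/lee_addgt0Pr => e e0.
have /fine_cvgP[_ /cvgrPdist_le /(_ _ e0)] := nneseries_tail_cvg sumDoo
  (fun k _ => outer_measure_ge0 mu (D k)).
move=> [k _ /(_ k (leqnn k))] /=; rewrite sub0r normrN => ke.
apply: le_trans (FE k) _; rewrite leeD2l//.
have tailfin : \sum_(k <= j <oo) mu (D j) \is a fin_num.
  rewrite ge0_fin_numE; last by apply: nneseries_ge0 => *; exact: outer_measure_ge0.
  apply: le_lt_trans sumDoo; rewrite [leRHS](nneseries_split 0 k).
    by rewrite leeDr// sume_ge0// => *; exact: outer_measure_ge0.
  by move=> *; exact: outer_measure_ge0.
by rewrite -(fineK tailfin) lee_fin; apply: le_trans (ler_norm _) ke.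
Qed.

End caratheodory_criterion.

Section hausdorff_measure.
Context {R : realType} {n : nat}.
Variable s : R.

HB.instance Definition _ := isOuterMeasure.Build R 'rV[R]_n (@hausdorff R n s)
  (hausdorff0 s) (hausdorff_ge0 s) (@hausdorff_subset R n s)
  (hausdorff_sigma_subadditive s).

Hypothesis s0 : 0 <= s.

(** [O] is exhausted by its points of depth [1/(k+1)]. By the triangle inequality, [F k] and the
    complement of [F k.+1] are [1/(k+1) - 1/(k+2)] apart; the balls are those of the maximum norm,
    which the Euclidean norm dominates. *)
Lemma open_caratheodory (O : set 'rV[R]_n) : open O ->
  (@hausdorff R n s).-caratheodory O.
Proof.
move=> Oo; pose F k := [set x : 'rV[R]_n | ball x k.+1%:R^-1 `<=` O].
have -> : O = \bigcup_k F k.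
  apply/seteqP; split => [x Ox|x [k _ Fx]]; last first.
    by apply: Fx; apply: ballxx; rewrite invr_gt0.
  have /nbhs_ballP[e /= e0 xe] : nbhs x O by exact: open_nbhs_nbhs.
  exists (Num.truncn e^-1) => // y xy; apply: xe; apply: le_ball xy.
  rewrite -[leRHS]invrK lef_pV2 ?posrE ?invr_gt0//.
  by apply: ltW; rewrite truncnS_gt.
apply: caratheodory_measurable_exhaustion => [k x Fx y xy|k A B AF BF].
  by apply: Fx; apply: le_ball xy; rewrite lef_pV2 ?posrE// ler_nat.
pose e : R := k.+1%:R^-1 - k.+2%:R^-1.
have e0 : 0 < e by rewrite subr_gt0 ltf_pV2 ?posrE// ltr_nat.
apply: (hausdorff_separated s s0 _ _ e e0) => x y Ax By; rewrite leNgt; apply/negP => xy.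
apply: (BF y By) => z yz; apply: (AF x Ax).
have -> : k.+1%:R^-1 = e + k.+2%:R^-1 by rewrite subrK.
apply: ball_triangle yz; split=> // i j; rewrite (ord1 i).
apply: le_lt_trans xy; rewrite /ball_ /=.
by have := coord_le_lq_norm2 (x - y) j; rewrite !mxE.
Qed.

Lemma borel_caratheodory (A : set (borel_rV R n)) : measurable A ->
  (@hausdorff R n s).-caratheodory A.
Proof.
move=> mA; apply: (@smallest_sub _ (sigma_algebra setT) (@open 'rV[R]_n)
  (@hausdorff R n s).-caratheodory _ _ A mA); last first.
  by move=> O; exact: open_caratheodory.
split.
- exact: caratheodory_measurable_set0.
- by move=> B mB; rewrite setTD; exact: caratheodory_measurable_setC.
- exact: caratheodory_measurable_bigcup.
Qed.

End hausdorff_measure.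

(** * Maps contracting all directions but one *)

Section anisotropic_lipschitz.
Context {R : realType} {n : nat}.
Variables (s : R) (B : set 'rV[R]_n) (Psi : 'rV[R]_n -> 'rV[R]_n).
Variables (ell : 'rV[R]_n -> R) (L eta kappa M : R) (N : nat).
Hypotheses (s0 : 0 <= s) (eta0 : 0 < eta) (M0 : 0 < M).
Hypothesis LM : L ^+ 2 + eta ^+ 2 <= M ^+ 2.
Hypothesis kappaN : kappa <= N%:R * eta.
Hypothesis Psi_dist : forall x y, B x -> B y ->
  lq_norm 2%:E (Psi x - Psi y) ^+ 2 <=
  L ^+ 2 * lq_norm 2%:E (x - y) ^+ 2 + (ell x - ell y) ^+ 2.
Hypothesis ell_lip : forall x y, B x -> B y ->
  `|ell x - ell y| <= kappa * lq_norm 2%:E (x - y).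

(** Slices of thickness [eta * d] between level sets of [ell]. The shift by [N] makes the indices
    [0] to [2 N] cover all heights within [N * eta * d] of [ell x0]. *)
Let piece (U : set 'rV[R]_n) (d : R) (x0 : 'rV[R]_n) (j : nat) :=
  [set x | [/\ U x, B x & (j%:R - N%:R) * (eta * d) <= ell x - ell x0
                          <= (j%:R - N%:R + 1) * (eta * d)]].

Let piece_diam U d x0 j : (forall x y, U x -> U y -> lq_norm 2%:E (x - y) <= d) ->
  0 <= d -> (ediam (Psi @` piece U d x0 j) <= (M * d)%:E)%E.
Proof.
move=> Ud d0; apply: ediam_le => [|_ _ [x [Ux Bx Ix] <-] [y [Uy By Iy] <-]].
  by rewrite mulr_ge0// ltW.
rewrite -(ler_pXn2r (ltn0Sn 1)) ?nnegrE ?lq_norm_ge0 ?mulr_ge0 ?(ltW M0)//.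
apply: le_trans (Psi_dist _ _ Bx By) _.
have ed0 : 0 <= eta * d by rewrite mulr_ge0 ?(ltW eta0).
have lxy : (ell x - ell y) ^+ 2 <= (eta * d) ^+ 2.
  rewrite -[leLHS]real_normK ?num_real// ler_pXn2r ?nnegrE// ler_norml.
  by move: Ix Iy; rewrite !mulrDl !mulNr !mul1r; lra.
have dxy : lq_norm 2%:E (x - y) ^+ 2 <= d ^+ 2.
  by rewrite ler_pXn2r ?nnegrE ?lq_norm_ge0// Ud.
apply: le_trans (lerD (ler_wpM2l (sqr_ge0 L) dxy) lxy) _.
by rewrite !exprMn -mulrDl ler_wpM2r// sqr_ge0.
Qed.

Let piece_cover U d x0 : (forall x y, U x -> U y -> lq_norm 2%:E (x - y) <= d) ->
  0 <= d -> U x0 -> B x0 ->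
  U `&` B `<=` \big[setU/set0]_(j < N.*2.+1) piece U d x0 j.
Proof.
move=> Ud d0 Ux0 Bx0 x [Ux Bx].
have lx : `|ell x - ell x0| <= N%:R * (eta * d).
  apply: le_trans (ell_lip _ _ Bx Bx0) _; rewrite mulrA.
  have := Ud _ _ Ux Ux0; have := lq_norm_ge0 2%:E (x - x0).
  move=> ? /(ler_wpM2l (mulr_ge0 (ler0n _ N) (ltW eta0))); apply: le_trans.
  exact: ler_wpM2r.
(* When [d = 0] all slices coincide with the level of [x0], and index [0] serves. *)
rewrite -bigcup_mkord; have [ed|ed] := eqVneq (eta * d) 0.
  exists 0%N => //; split=> //; move: lx.
  by rewrite ed !mulr0 normr_le0 => /eqP->; rewrite lexx.
have {ed} ed0 : 0 < eta * d by rewrite lt_neqAle eq_sym ed mulr_ge0// ltW.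
move: lx; rewrite ler_norml => /andP[lx1 lx2].
(* The height in units of the thickness, counted from the lowest slice; its integer part is the
   index sought. *)
pose t := (ell x - ell x0) / (eta * d) + N%:R.
have tE : ell x - ell x0 = (t - N%:R) * (eta * d) by rewrite addrK divfK// gt_eqF.
have t0 : 0 <= t by rewrite -lerBlDr sub0r ler_pdivlMr// mulNr.
have tN : t <= N.*2%:R.
  by rewrite -addnn natrD; apply: lerD => //; rewrite ler_pdivrMr.
have /andP[jt tj] := truncn_itv t0.
exists (Num.truncn t).
  by rewrite /= ltnS -(ler_nat R) (le_trans jt).
rewrite -natr1 in tj.
by split=> //; rewrite tE !ler_pM2r//; apply/andP; split; lra.
Qed.

Let content_stretch U d : 0 < d -> (ediam U <= d%:E)%E ->
  (hausdorff_content s (M * d) (Psi @` (U `&` B)) <=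
   (N.*2.+1%:R * M `^ s)%:E * hausdorff_gauge s U)%E.
Proof.
move=> d0 Ud; have Md0 : 0 <= M * d by rewrite mulr_ge0// ltW.
have [->|/set0P[x0 [Ux0 Bx0]]] := eqVneq (U `&` B) set0.
  rewrite image_set0 content0// mule_ge0 ?gauge_ge0//.
  by rewrite lee_fin mulr_ge0// powR_ge0.
have UE : ediam U = (fine (ediam U))%:E.
  rewrite fineK// ge0_fin_numE ?ediam_ge0//.
  by rewrite (le_lt_trans Ud)// ltey.
(* The slices are cut at the exact diameter [r], not at the scale [d], so that each image is
   compared with the gauge of [U] itself. *)
set r := fine _ in UE; have r0 : 0 <= r by rewrite -lee_fin -UE ediam_ge0.
have rd : r <= d by rewrite -lee_fin -UE.
have Ur x y : U x -> U y -> lq_norm 2%:E (x - y) <= r.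
  by move=> Ux Uy; rewrite -lee_fin -UE; exact: le_ediam.
pose om := isOuterMeasure.Build R 'rV[R]_n (@hausdorff_content R n s (M * d))
  (content0 s _ Md0) (content_ge0 s _) (@content_subset R n s _)
  (content_sigma_subadditive s _).
pose mu : {outer_measure set 'rV[R]_n -> \bar R} :=
  HB.pack (@hausdorff_content R n s (M * d)) om.
have cov : Psi @` (U `&` B) `<=`
    \big[setU/set0]_(j < N.*2.+1) (Psi @` piece U r x0 j).
  move=> _ [x Ux <-]; rewrite -(bigcup_mkord _ (fun j => Psi @` piece U r x0 j)).
  have := piece_cover _ _ _ Ur r0 Ux0 Bx0 _ Ux.
  by rewrite -bigcup_mkord => -[j jN jx]; exists j => //; exists x.
apply: le_trans (le_outer_measure mu _ _ cov) _.
apply: le_trans (outer_measure_subadditive mu (fun j => Psi @` piece U r x0 j) _) _.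
apply: (@le_trans _ _ (\sum_(j < N.*2.+1) (M `^ s * r `^ s)%:E)%E).
  apply: lee_sum => j _; have Vr := piece_diam U r x0 j Ur r0.
  apply: le_trans (content_le_gauge s _ _ Md0 _) _.
    by rewrite (le_trans Vr)// lee_fin ler_wpM2l// ltW.
  rewrite /hausdorff_gauge; case: ifPn => _.
    by rewrite lee_fin mulr_ge0 ?powR_ge0.
  rewrite -powRM ?(ltW M0)// -poweR_EFin.
  by apply: gt0_ler_poweR; rewrite ?in_itv/= ?ediam_ge0 ?leey// lee_fin mulr_ge0// ltW.
rewrite sumEFin sumr_const card_ord.
rewrite /hausdorff_gauge ifF; last by apply/negP => /eqP U0; rewrite U0 in Ux0.
by rewrite UE poweR_EFin -EFinM -mulrA mulr_natl.
Qed.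

(* [Psi] contracts by [L] in all directions but one, measured by [ell], which it
   may dilate by [kappa]. Slicing each set of a cover orthogonally to that
   direction costs a factor [2 N + 1] only, instead of the factor
   [kappa `^ s] of the isotropic Lipschitz bound. *)
Lemma hausdorff_stretch :
  (hausdorff s (Psi @` B) <= (N.*2.+1%:R * M `^ s)%:E * hausdorff s B)%E.
Proof.
have c0 : 0 < N.*2.+1%:R * M `^ s by rewrite mulr_gt0 ?powR_gt0 ?ltr0n.
apply: ge_ereal_sup => _ [e /= e0 <-].
pose d := e / M; have d0 : 0 < d by rewrite divr_gt0.
have -> : e = M * d by rewrite mulrC divfK// gt_eqF.
apply: (@le_trans _ _ ((N.*2.+1%:R * M `^ s)%:E * hausdorff_content s d B)%E);
  last by apply: lee_wpmul2l; [rewrite lee_fin ltW|exact: content_le_hausdorff].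
rewrite -lee_pdivrMl//; apply: le_ereal_inf_tmp => _ [U [BU Ud] <-].
rewrite lee_pdivrMl// -nneseriesZl; last by move=> i _; exact: gauge_ge0.
have cov : Psi @` B `<=` \bigcup_i (Psi @` (U i `&` B)).
  by move=> _ [x Bx <-]; have [i _ Ux] := BU x Bx; exists i => //; exists x.
apply: le_trans (content_subset s _ _ _ cov) _.
apply: le_trans (content_sigma_subadditive s _ _) _.
apply: lee_nneseries => [i _ _|i _]; first exact: content_ge0.
exact: content_stretch.
Qed.

End anisotropic_lipschitz.

(** * The surface measure and its integral *)

Import HBNNSimple.

(** The integral of [f] is a supremum over simple functions below it, and each of these lies below
    the measurable function [e + \1_A] on the whole space. *)
Lemma integral_le_indic {d} {T : measurableType d} {R : realType}
    (mu : {measure set T -> \bar R}) (D A : set T) (f : T -> R) (e : R) :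
  (mu setT <= 1)%E -> measurable A -> 0 <= e ->
  (forall x, D x -> 0 <= f x <= e + \1_A x) ->
  (\int[mu]_(x in D) (f x)%:E <= e%:E + mu A)%E.
Proof.
move=> mu1 mA e0 fe; rewrite ge0_integralE; last first.
  by move=> x /fe /andP[f0 _]; rewrite lee_fin.
apply: ge_ereal_sup => _ [h /= hle <-].
pose g x : \bar R := (e%:E + (\1_A x)%:E)%E.
have mg : measurable_fun setT g.
  by apply: emeasurable_funD => //; apply/measurable_EFinP; exact: measurable_indic.
have hg x : ((h x)%:E <= g x)%E.
  apply: le_trans (hle x) _; rewrite patchE; case: ifPn => [|_].
    by rewrite inE /g => /fe /andP[_]; rewrite -EFinD lee_fin.
  by rewrite /g adde_ge0// lee_fin.
rewrite -integralT_nnsfun; apply: (@le_trans _ _ (\int[mu]_x g x)%E).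
  apply: ge0_le_integral => //; first by move=> x _; rewrite lee_fin.
  by apply/measurable_EFinP; exact: measurable_funP.
rewrite ge0_integralD//=; last first.
  by apply/measurable_EFinP; exact: measurable_indic.
rewrite integral_indic// setIT integral_cst// leeD2r//.
by rewrite -[leRHS]mule1 lee_wpmul2l.
Qed.

Section surface_measure.
Context {R : realType} {n : nat} {p : R}.
Local Notation Delta := (@pos_lp_sphere R n p).
Local Notation H := (@hausdorff R n n.-1%:R).

(* Also true if [H Delta] is [0] or [+oo], where [surface_measure] is [0]. *)
Lemma surface_measureE : exists2 k : R, 0 <= k & forall A,
  surface_measure n p A = (k%:E * H (A `&` Delta))%E.
Proof.
have [H0|H0] := eqVneq (H Delta) 0%E.
  exists 0 => // A; rewrite mul0e /surface_measure.
  suff -> : H (A `&` Delta) = 0%E by rewrite mul0e.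
  apply/eqP; rewrite eq_le hausdorff_ge0 -H0 andbT.
  by apply: hausdorff_subset => x [].
have kfin : (H Delta)^-1%E \is a fin_num.
  by rewrite fin_numV// gt_eqF// (lt_le_trans _ (hausdorff_ge0 _ _)).
exists (fine (H Delta)^-1%E) => [|A].
  by rewrite fine_ge0// inve_ge0 hausdorff_ge0.
by rewrite fineK// muleC.
Qed.

Let mu := @surface_measure R n p.

Let mu0 : mu set0 = 0%E.
Proof.
by have [k _ muE] := surface_measureE; rewrite /mu muE set0I hausdorff0 mule0.
Qed.

Let mu_ge0 A : (0 <= mu A)%E.
Proof.
have [k k0 muE] := surface_measureE.
by rewrite /mu muE mule_ge0// hausdorff_ge0.
Qed.

(** One inequality is countable subadditivity of [H]; the other is Caratheodory's, for the Borel
    sets [F i] and the test set [X]. *)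
Let mu_sigma_additive : semi_sigma_additive mu.
Proof.
move=> F mF tF _; have [k k0 muE] := surface_measureE.
suff <- : (\sum_(0 <= i <oo) mu (F i))%E = mu (\bigcup_i F i).
  exact: is_cvg_nneseries.
rewrite /mu (eq_eseriesr (fun i _ => muE (F i))) muE nneseriesZl; last first.
  by move=> i _; exact: hausdorff_ge0.
congr (_ * _)%E; apply/eqP; rewrite eq_le; apply/andP; split; last first.
  rewrite setI_bigcupl; exact: hausdorff_sigma_subadditive.
have mFH i : (H).-caratheodory (F i) by apply: borel_caratheodory.
set X := _ `&` _.
have := @caratheodory_lime_le _ _ (H : {outer_measure set 'rV[R]_n -> \bar R}) F mFH tF X.
apply: le_trans; rewrite -[leLHS]adde0; apply: leeD; last exact: outer_measure_ge0.
apply: lee_nneseries => i _; first by move=> _; exact: hausdorff_ge0.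
by apply: hausdorff_subset => x [Fx Dx]; split => //; split => //; exists i.
Qed.

HB.instance Definition _ := isMeasure.Build _ (borel_rV R n) R
  (@surface_measure R n p) mu0 mu_ge0 mu_sigma_additive.

Lemma surface_measure_le1 A : (surface_measure n p A <= 1)%E.
Proof.
apply: (@le_trans _ _ (surface_measure n p setT)).
  have [k k0 muE] := surface_measureE.
  rewrite !muE lee_wpmul2l ?lee_fin//; apply: hausdorff_subset.
  by move=> x [].
rewrite /surface_measure setTI.
have [->|H0] := eqVneq (H Delta) 0%E; first by rewrite mul0e lee01.
have [->|Hoo] := eqVneq (H Delta) +oo%E; first by rewrite invey mule0 lee01.
by rewrite divee// ge0_fin_numE ?ltey// hausdorff_ge0.
Qed.

(** Multiplying by the factor [k] of [surface_measureE] instead of dividing by [H Delta] treats the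
    values [0] and [+oo] along with the others. *)
Lemma surface_measure_le_ratio A (c : R) : 0 <= c ->
  (H (A `&` Delta) <= c%:E * H Delta)%E -> (surface_measure n p A <= c%:E)%E.
Proof.
move=> c0 Ac; have [k k0 muE] := surface_measureE.
rewrite muE; apply: le_trans (lee_wpmul2l _ Ac) _; rewrite ?lee_fin//.
rewrite muleCA -[H Delta](congr1 H (setTI Delta)) -muE -[leRHS]mule1.
by apply: lee_wpmul2l; rewrite ?lee_fin// surface_measure_le1.
Qed.

Lemma best_approx_error0_ge0 q (x : 'rV[R]_n) : 0 <= best_approx_error 0 q x.
Proof.
apply: lb_le_inf; last by move=> _ [y _ <-]; exact: lq_norm_ge0.
exists (lq_norm q (x - 0)), 0 => //=.
by rewrite leqn0; apply/eqP/eq_card0 => i; rewrite inE mxE eqxx.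
Qed.

Lemma best_approx_error0_le q (x : 'rV[R]_n) :
  best_approx_error 0 q x <= lq_norm q x.
Proof.
apply: ge_inf; first by exists 0 => _ [y _ <-]; exact: lq_norm_ge0.
exists 0; rewrite ?subr0//=.
by rewrite leqn0; apply/eqP/eq_card0 => i; rewrite inE mxE eqxx.
Qed.

Lemma avg_best_approx_error0_le q (e : R) (A : set (borel_rV R n)) :
  0 <= e -> measurable A ->
  (forall x, Delta x -> lq_norm q x <= e + \1_A x) ->
  (avg_best_approx_error 0 p q (surface_measure n p) <=
   e%:E + surface_measure n p A)%E.
Proof.
move=> e0 mA De; apply: integral_le_indic => //.
  exact: surface_measure_le1.
move=> x Dx; rewrite best_approx_error0_ge0/=.
exact: le_trans (best_approx_error0_le q x) (De x Dx).
Qed.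

End surface_measure.

(** * Tails of a coordinate on the sphere *)

(** On [[m, 1]] the derivative [r t^r / t] is at most [r / m], whether [r] is below or above [1].
    The proof writes [a^r = b^r expR (- r ln (b / a))] and uses the tangent bounds of [expR] and
    [ln]. *)
Lemma powR_lipschitz {R : realType} (r m a b : R) : 0 < r -> 0 < m ->
  m <= a <= 1 -> m <= b <= 1 -> `|a `^ r - b `^ r| <= r / m * `|a - b|.
Proof.
move=> r0 m0; wlog ab : a b / a <= b => [wlg|].
  have [ab|/ltW ba] := leP a b; first exact: wlg.
  by move=> ? ?; rewrite distrC (distrC a) wlg.
move=> /andP[ma a1] /andP[mb b1].
have a0 : 0 < a by exact: lt_le_trans ma.
have b0 : 0 < b by exact: lt_le_trans mb.
have q0 : 0 < b / a by rewrite divr_gt0.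
rewrite !ler0_norm ?subr_le0 ?ge0_ler_powR ?nnegrE ?(ltW r0) ?(ltW a0) ?(ltW b0)//.
rewrite !opprB.
have lnq : ln (b / a) <= b / a - 1.
  by have := @le_ln1Dx _ (b / a - 1); rewrite (addrC 1) subrK; apply; lra.
have aE : a `^ r = b `^ r * expR (- (r * ln (b / a))).
  rewrite -mulrN -lnV ?posrE// invf_div.
  have -> : expR (r * ln (a / b)) = (a / b) `^ r by rewrite /powR gt_eqF ?divr_gt0.
  by rewrite -powRM ?ltW ?divr_gt0// mulrC divfK// gt_eqF.
have e1 : 1 - r * (b / a - 1) <= expR (- (r * ln (b / a))).
  by apply: le_trans (expR_ge1Dx _); rewrite lerD2l lerN2 ler_pM2l.
have br1 : b `^ r <= 1.
  by rewrite -[leRHS](congr1 (@^~ r) (powR1 R)) ge0_ler_powR ?nnegrE ?(ltW r0) ?(ltW b0).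
have bam : b / a - 1 <= (b - a) / m.
  rewrite -(divff (lt0r_neq0 a0)) -mulrBl ler_wpM2l ?subr_ge0//.
  by rewrite lef_pV2 ?posrE.
have ba1 : 0 <= b / a - 1 by rewrite subr_ge0 ler_pdivlMr// mul1r.
have br0 : 0 <= b `^ r by exact: powR_ge0.
have : b `^ r - a `^ r <= b `^ r * (r * (b / a - 1)).
  rewrite aE -{1}[b `^ r]mulr1 -mulrBr ler_wpM2l//.
  by rewrite lerBlDr addrC -lerBlDr.
move=> /le_trans; apply.
apply: (@le_trans _ _ (r * (b / a - 1))).
  by rewrite ler_piMl// mulr_ge0// ltW.
by rewrite mulrAC -mulrA ler_wpM2l// ltW.
Qed.

Section sphere_tail.
Context {R : realType} {n : nat} {p : R}.
Hypothesis p0 : 0 < p.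
Variables (i : 'I_n) (tau : R).
Hypotheses (tau0 : 0 < tau) (tau1 : tau < 1).
Local Notation Delta := (@pos_lp_sphere R n p).
Local Notation H := (@hausdorff R n n.-1%:R).

Let B := [set x | Delta x /\ tau <= x 0 i `^ p].
Let ell (x : 'rV[R]_n) := (tau + (1 - tau) * x 0 i `^ p) `^ p^-1.
Let L := (1 - tau) `^ p^-1.
Let Psi (x : 'rV[R]_n) : 'rV[R]_n :=
  \row_j (if j == i then ell x else L * x 0 j).

Let pV0 : 0 < p^-1. Proof. by rewrite invr_gt0. Qed.

Let powRVK (a : R) : 0 <= a -> (a `^ p^-1) `^ p = a.
Proof. by move=> a0; rewrite -powRrM mulVf ?gt_eqF// powRr1. Qed.

Let powRKV (a : R) : 0 <= a -> (a `^ p) `^ p^-1 = a.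
Proof. by move=> a0; rewrite -powRrM mulfV ?gt_eqF// powRr1. Qed.

Let L0 : 0 < L. Proof. by rewrite powR_gt0 ?subr_gt0. Qed.

Lemma pos_lp_sphere_powR_le1 x j : Delta x -> x 0 j `^ p <= 1.
Proof.
move=> [_ <-]; rewrite (bigD1 j)//= lerDl.
by apply: sumr_ge0 => k _; exact: powR_ge0.
Qed.

Let Psi_dist x y :
  lq_norm 2%:E (Psi x - Psi y) ^+ 2 <=
  L ^+ 2 * lq_norm 2%:E (x - y) ^+ 2 + (ell x - ell y) ^+ 2.
Proof.
rewrite [leLHS]lq_norm2_sqr [X in _ * X + _]lq_norm2_sqr.
rewrite (bigD1 i)//=.
have -> : (Psi x - Psi y) 0 i = ell x - ell y by rewrite !mxE eqxx.
rewrite addrC lerD2r.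
rewrite (eq_bigr (fun j => L ^+ 2 * (x - y) 0 j ^+ 2)); last first.
  by move=> j /negbTE ji; rewrite !mxE ji -mulrBr exprMn.
rewrite -big_distrr/= ler_wpM2l ?sqr_ge0//.
by rewrite [leRHS](bigD1 i)//= lerDr sqr_ge0.
Qed.

(** Two powers are composed: exponent [p] on [[tau^(1/p), 1]], then exponent [1/p] on [[tau, 1]].
    The factors [p] and [1/p] of their Lipschitz constants cancel, and [1 - tau] is bounded by
    [1]. *)
Let ell_lip x y : B x -> B y ->
  `|ell x - ell y| <= (tau * tau `^ p^-1)^-1 * lq_norm 2%:E (x - y).
Proof.
have tp0 : 0 < tau `^ p^-1 by rewrite powR_gt0.
have coordB z : B z -> tau `^ p^-1 <= z 0 i <= 1.
  move=> [Dz tz]; have z0 : 0 <= z 0 i by case: Dz.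
  rewrite -[z 0 i]powRKV//; apply/andP; split.
    by rewrite ge0_ler_powR ?nnegrE ?powR_ge0 ?(ltW tau0) ?(ltW pV0).
  rewrite -[leRHS](congr1 (@^~ p^-1) (powR1 R)) ge0_ler_powR ?nnegrE ?powR_ge0 ?(ltW pV0)//.
  exact: pos_lp_sphere_powR_le1.
have argB z : B z -> tau <= tau + (1 - tau) * z 0 i `^ p <= 1.
  move=> [Dz tz]; have := pos_lp_sphere_powR_le1 z i Dz; have := powR_ge0 (z 0 i) p.
  move=> ? ?; rewrite lerDl mulr_ge0 ?subr_ge0 ?(ltW tau1)//= -lerBrDl.
  by rewrite ler_piMr// subr_ge0 ltW.
move=> Bx By; apply: le_trans (powR_lipschitz _ _ _ _ pV0 tau0 (argB _ Bx) (argB _ By)) _.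
rewrite opprD addrACA subrr add0r -mulrBr normrM ger0_norm ?subr_ge0 ?(ltW tau1)//.
have := powR_lipschitz _ _ _ _ p0 tp0 (coordB _ Bx) (coordB _ By).
have := coord_le_lq_norm2 (x - y) i; rewrite !mxE => xy lxy.
apply: (@le_trans _ _ (p^-1 / tau * (p / tau `^ p^-1 * lq_norm 2%:E (x - y)))).
  rewrite ler_wpM2l ?divr_ge0 ?(ltW pV0) ?(ltW tau0)//.
  apply: le_trans (_ : 1 * `|x 0 i `^ p - y 0 i `^ p| <= _).
    by rewrite ler_wpM2r// gerBl ltW.
  rewrite mul1r (le_trans lxy)// ler_wpM2l ?divr_ge0 ?(ltW p0) ?(ltW tp0)//.
rewrite mulrA; apply: ler_wpM2r; first exact: lq_norm_ge0.
by rewrite mulrACA mulVf ?gt_eqF// mul1r invfM.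
Qed.

Let Psi_onto : [set x | Delta x /\ 2 * tau <= x 0 i `^ p] `<=` Psi @` B.
Proof.
move=> x [Dx xt]; have [x0 x1] := Dx.
have t10 : 0 < 1 - tau by rewrite subr_gt0.
(* The solution of [tau + (1 - tau) v = x_i^p]. *)
pose v := (x 0 i `^ p - tau) / (1 - tau).
have v0 : 0 <= v by rewrite divr_ge0 ?(ltW t10)//; move: xt tau0; lra.
pose y : 'rV[R]_n := \row_j (if j == i then v `^ p^-1 else x 0 j / L).
have yi : y 0 i `^ p = v by rewrite mxE eqxx powRVK.
exists y.
  split; last first.
    (* [v >= tau] amounts to [x_i^p >= 2 tau - tau^2], whence the threshold [2 tau]. *)
    by rewrite yi ler_pdivlMr// mulrBr mulr1; have := mulr_gt0 tau0 tau0; move: xt; lra.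
  split=> [j|].
    by rewrite mxE; case: ifP => _; rewrite ?powR_ge0// divr_ge0 ?(ltW L0).
  rewrite (bigD1 i)//= yi.
  rewrite (eq_bigr (fun j => (1 - tau)^-1 * x 0 j `^ p)); last first.
    move=> j /negbTE ji; rewrite mxE ji powRM ?invr_ge0 ?(ltW L0)// mulrC.
    by rewrite -powRN -powRrM mulNr mulVf ?gt_eqF// powR_inv1 ?ltW.
  rewrite -big_distrr/= /v mulrC -mulrDr.
  move: x1; rewrite (bigD1 i)//= => /(congr1 (fun z => z - tau)).
  by rewrite addrAC => ->; rewrite mulVf// gt_eqF.
apply/rowP => j; rewrite mxE; case: eqVneq => [->|ji].
  rewrite /ell yi mulrC divfK ?gt_eqF// addrC subrK powRKV//.
by rewrite mxE (negbTE ji) mulrC divfK// gt_eqF.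
Qed.

Lemma sphere_tail_stretch (eta M : R) (N : nat) : 0 < eta -> 0 < M ->
  (1 - tau) `^ p^-1 ^+ 2 + eta ^+ 2 <= M ^+ 2 ->
  (tau * tau `^ p^-1)^-1 <= N%:R * eta ->
  (H [set x | Delta x /\ (2 * tau <= x 0 i `^ p)%R] <=
   (N.*2.+1%:R * M `^ n.-1%:R)%:E * H Delta)%E.
Proof.
move=> eta0 M0 LM kN.
apply: le_trans (hausdorff_subset _ _ _ Psi_onto) _.
apply: le_trans (hausdorff_stretch _ _ _ _ _ _ _ _ _ _ eta0 M0 LM kN _ ell_lip) _.
- by rewrite ler0n.
- by move=> x y _ _; exact: Psi_dist.
apply: lee_wpmul2l; first by rewrite lee_fin mulr_ge0// powR_ge0.
by apply: hausdorff_subset => x [].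
Qed.

End sphere_tail.

(** * Choice of constants *)

Lemma powR_inv {R : realType} (a r : R) : 0 <= a -> a^-1 `^ r = (a `^ r)^-1.
Proof. by move=> a0; rewrite -powR_inv1// -powRrM mulrC powRrM powR_inv1 ?powR_ge0. Qed.

Lemma ln_ge_half {R : realType} (a : R) : 2 <= a -> 2^-1 <= ln a.
Proof.
move=> a2; have a0 : 0 < a by lra.
have ai : a^-1 <= 2^-1 by rewrite lef_pV2 ?posrE.
have := @le_ln1Dx R (a^-1 - 1); rewrite (addrC 1) subrK lnV ?posrE// => h.
have {h} : - ln a <= a^-1 - 1 by apply: h; rewrite ltrBrDl subrr invr_gt0.
by lra.
Qed.

Section sphere_max_tail.
Context {R : realType} {n : nat} {p : R}.
Hypotheses (p0 : 0 < p) (n2 : (2 <= n)%N).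
Local Notation Delta := (@pos_lp_sphere R n p).
Local Notation H := (@hausdorff R n n.-1%:R).
Local Notation q := (p^-1).

Let q0 : 0 < q. Proof. by rewrite invr_gt0. Qed.
Let n0 : 0 < n%:R :> R. Proof. by rewrite ltr0n (leq_trans _ n2). Qed.
Let n1 : 1 <= n%:R :> R. Proof. by rewrite ler1n (leq_trans _ n2). Qed.
(** The slices have relative thickness [eta = 1/n]. The resulting excess over the contraction
    [expR (- tau / p)] is absorbed by [expR (b / n)], whose power [n - 1] stays below [expR b]. *)
Let b : R := expR (2 * q) / 2.
Let M (tau : R) := expR (- (tau * q) + b / n%:R).

Let stretch_factor (tau : R) : 0 < tau -> tau < 1 ->
  ((1 - tau) `^ q) ^+ 2 + n%:R^-1 ^+ 2 <= M tau ^+ 2.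
Proof.
move=> tau0 tau1; rewrite /M expRD exprMn.
have E1 : ((1 - tau) `^ q) ^+ 2 <= expR (- (tau * q)) ^+ 2.
  rewrite ler_pXn2r ?nnegrE ?powR_ge0 ?expR_ge0// -mulNr expRM.
  rewrite ge0_ler_powR ?nnegrE ?expR_ge0 ?(ltW q0) ?subr_ge0 ?(ltW tau1)//.
  exact: expR_ge1Dx.
have E2 : 1 + expR (2 * q) / n%:R <= expR (b / n%:R) ^+ 2.
  rewrite -expRM_natl; apply: le_trans (expR_ge1Dx _).
  by rewrite lerD2l /b mulrA mulrCA divff ?mulr1.
(* Uses [expR (2 q (1 - tau)) >= 1], which is what the factor [expR (2 q)] in [b] is for. *)
have E3 : n%:R^-1 ^+ 2 <= expR (- (tau * q)) ^+ 2 * (expR (2 * q) / n%:R).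
  rewrite -expRM_natl mulrA -expRD expr2.
  rewrite ler_pM2r ?invr_gt0//; apply: (@le_trans _ _ 1); first by rewrite invf_le1.
  rewrite -expR0 ler_expR -mulrDr mulr_ge0// addrC subr_ge0.
  by rewrite ler_piMl ?(ltW q0)// ltW.
apply: le_trans (lerD E1 E3) _; rewrite -{1}[expR _ ^+ 2]mulr1 -mulrDr.
by rewrite ler_wpM2l// sqr_ge0.
Qed.

Let stretch_factor_powR (tau : R) : 0 < tau ->
  M tau `^ n.-1%:R <= expR b * expR (- (n%:R * tau * q / 2)).
Proof.
move=> tau0; rewrite /M -expRM -expRD ler_expR.
have nE : n%:R = n.-1%:R + 1 :> R by rewrite natr1 prednK// (leq_trans _ n2).
have m1 : 1 <= n.-1%:R :> R by rewrite ler1n -ltnS prednK// (leq_trans _ n2).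
rewrite mulrDl addrC; apply: lerD.
  rewrite mulrAC -mulrA ler_piMr ?divr_ge0 ?expR_ge0//.
  by rewrite ler_pdivrMr// mul1r nE lerDl.
(* The half in the exponent comes from [n - 1 >= n / 2]. *)
have -> : n%:R * tau * q / 2 = tau * q * (n%:R / 2) by ring.
by rewrite mulNr lerN2 ler_pM2l ?mulr_gt0// nE; lra.
Qed.

Let slice_count (tau : R) : 0 < tau -> n%:R^-1 <= tau ->
  exists2 N : nat, (tau * tau `^ q)^-1 <= N%:R * n%:R^-1 &
    N.*2.+1%:R <= 5 * (n.+1%:R ^+ 2 * n.+1%:R `^ q) :> R.
Proof.
move=> tau0 ntau; set k := (_ * _)^-1.
have k0 : 0 <= k by rewrite invr_ge0 mulr_ge0 ?powR_ge0 ?(ltW tau0).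
have kn0 : 0 <= k * n%:R by rewrite mulr_ge0// ltW.
exists (Num.truncn (k * n%:R)).+1.
  by rewrite ler_pdivlMr// ltW// truncnS_gt.
have na : n%:R <= n.+1%:R :> R by rewrite ler_nat.
have kle : k <= n%:R * n%:R `^ q.
  rewrite /k invfM ler_pM ?invr_ge0 ?powR_ge0 ?(ltW tau0)//.
    by rewrite -[leRHS]invrK lef_pV2 ?posrE ?invr_gt0.
  rewrite -[leRHS]invrK lef_pV2 ?posrE ?invr_gt0 ?powR_gt0//.
  rewrite -powR_inv ?(ltW n0)//.
  by apply: ge0_ler_powR; rewrite ?nnegrE ?invr_ge0 ?(ltW n0) ?(ltW p0) ?(ltW tau0).
have nq : n%:R `^ q <= n.+1%:R `^ q.
  by rewrite ge0_ler_powR ?nnegrE ?(ltW q0).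
have a1 : 1 <= n.+1%:R `^ q.
  rewrite -[leLHS](congr1 (@^~ q) (powR1 R)) ge0_ler_powR ?nnegrE ?(ltW q0)//.
  exact: le_trans na.
have aa : 1 <= n.+1%:R ^+ 2 :> R by rewrite exprn_ege1// (le_trans n1).
have kna : k * n%:R <= n.+1%:R ^+ 2 * n.+1%:R `^ q.
  apply: (@le_trans _ _ (n.+1%:R * n.+1%:R `^ q * n.+1%:R)).
    rewrite ler_pM// (le_trans kle)// ler_pM ?powR_ge0//.
  by rewrite mulrAC -expr2.
have /andP[tr _] := truncn_itv kn0.
have aaq : 1 <= n.+1%:R ^+ 2 * n.+1%:R `^ q :> R.
  by rewrite -[leLHS]mulr1 ler_pM.
(* [2 N + 1 <= 2 k n + 3], where [k n] and [1] are both at most [(n+1)^2 (n+1)^q]: hence the factor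
   [5]. *)
rewrite -natr1 -addnn natrD -natr1.
by move: tr kna aaq; lra.
Qed.

Let coord_tail (tau : R) (i : 'I_n) : 0 < tau -> tau < 1 -> n%:R^-1 <= tau ->
  (H [set x | Delta x /\ (2 * tau <= x 0 i `^ p)%R] <=
   (5 * (n.+1%:R ^+ 2 * n.+1%:R `^ q) *
    (expR b * expR (- (n%:R * tau * q / 2))))%:E * H Delta)%E.
Proof.
move=> tau0 tau1 ntau; have [N kN NN] := slice_count tau tau0 ntau.
apply: le_trans (sphere_tail_stretch p0 i tau tau0 tau1 n%:R^-1 (M tau) N _ _ _ kN) _.
- by rewrite invr_gt0.
- exact: expR_gt0.
- exact: stretch_factor.
apply: lee_wpmul2r; first exact: hausdorff_ge0.
by rewrite lee_fin ler_pM ?powR_ge0// stretch_factor_powR.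
Qed.

(** With [tau = K ln a / n] and [a = n + 1], the decay is [a^(-3 - 2q)]: it pays for the slices,
    [a^(2 + q)], and the union bound, [n], and leaves [a^(-q)]. Moreover [K >= 4] ensures
    [tau >= 1/n]. *)
Let K : R := 6 * p + 4.

Let a : R := n.+1%:R.

Let a2 : 2 <= a. Proof. by rewrite ler_nat ltnS (leq_trans _ n2). Qed.

Let tail_constant :
  n%:R * (5 * (a ^+ 2 * a `^ q) *
    (expR b * expR (- (n%:R * (K * ln a / n%:R) * q / 2)))) <=
  5 * expR b * 2 `^ q * (ln a / n%:R) `^ q.
Proof.
have a0 : 0 < a by apply: lt_le_trans a2.
have aq0 : 0 < a `^ q by exact: powR_gt0.
have na : n%:R <= a by rewrite ler_nat.
have -> : n%:R * (K * ln a / n%:R) * q / 2 = (3 + 2 * q) * ln a.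
  rewrite /K; field.
  by rewrite !gt_eqF.
have -> : expR (- ((3 + 2 * q) * ln a)) = (a ^+ 3 * (a `^ q) ^+ 2)^-1.
  have -> : a `^ q = expR (q * ln a) by rewrite /powR gt_eqF.
  have -> : a ^+ 3 = expR (3 * ln a) by rewrite expRM_natl lnK ?posrE.
  by rewrite expRN -expRM_natl -expRD mulrDl mulrA.
(* Follows from [n <= a] and [ln a >= 1/2]; it turns the remaining [a^(-q)] into the target rate. *)
have la : a^-1 <= 2 * (ln a / n%:R).
  rewrite mulrA ler_pdivlMr//; apply: (@le_trans _ _ 1).
    by rewrite mulrC ler_pdivrMr// mul1r.
  by have := ln_ge_half a a2; lra.
have lan : (a `^ q)^-1 <= 2 `^ q * (ln a / n%:R) `^ q.
  have ln0 : 0 <= ln a / n%:R.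
    by rewrite divr_ge0 ?(ltW n0)//; have := ln_ge_half a a2; lra.
  rewrite -powRM// -powR_inv ?(ltW a0)//.
  apply: ge0_ler_powR; rewrite ?nnegrE ?invr_ge0 ?(ltW p0) ?(ltW a0)//.
  exact: mulr_ge0.
rewrite -[leRHS]mulrA.
apply: le_trans (ler_wpM2l _ lan); last by rewrite mulr_ge0 ?expR_ge0.
rewrite [leLHS](_ : _ = n%:R / a * (5 * expR b * (a `^ q)^-1)); last first.
  by field; rewrite !gt_eqF.
rewrite ler_piMl ?mulr_ge0 ?invr_ge0 ?expR_ge0 ?powR_ge0//.
by rewrite ler_pdivrMr// mul1r.
Qed.

Lemma sphere_max_tail :
  (surface_measure n p [set x : 'rV[R]_n | exists i,
     ((2 * (K * ln a / n%:R)) `^ q < x 0 i)%R] <=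
   (5 * expR b * 2 `^ q * (ln a / n%:R) `^ q)%:E)%E.
Proof.
set tau := K * ln a / n%:R.
have lna := ln_ge_half a a2.
have tau_n : n%:R^-1 <= tau.
  rewrite -[leLHS]mul1r ler_wpM2r ?invr_ge0 ?(ltW n0)//.
  have : 4 * 2^-1 <= K * ln a by rewrite ler_pM// /K; have := p0; lra.
  by lra.
have tau0 : 0 < tau by apply: lt_le_trans tau_n; rewrite invr_gt0.
apply: surface_measure_le_ratio.
  by rewrite !mulr_ge0 ?expR_ge0 ?powR_ge0.
set A := [set x | _] `&` _.
pose F j := [set x | exists2 i : 'I_n, i = j :> nat & Delta x /\ 2 * tau <= x 0 i `^ p].
have AF : A `<=` \big[setU/set0]_(j < n) F j.
  rewrite -bigcup_mkord => x [[i xi] Dx]; exists i => //=; exists i => //; split=> //.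
  have -> : 2 * tau = ((2 * tau) `^ q) `^ p.
    by rewrite -powRrM mulVf ?gt_eqF// powRr1// mulr_ge0// ltW.
  apply: ge0_ler_powR; rewrite ?nnegrE ?powR_ge0 ?(ltW p0) ?(ltW xi)//.
  by case: Dx.
(* For [tau >= 1/2] the threshold is at least [1], which no coordinate on the sphere exceeds. *)
have [tau1|tau1] := ltP tau 2^-1; last first.
  suff -> : A = set0.
    by rewrite hausdorff0 mule_ge0 ?hausdorff_ge0// lee_fin !mulr_ge0 ?expR_ge0 ?powR_ge0.
  apply/seteqP; split=> // x [[i xi] Dx].
  have x1 := pos_lp_sphere_powR_le1 x i Dx.
  have x0 : 0 <= x 0 i by case: Dx.
  suff /(gt0_ltr_powR p0) : 1 < x 0 i.
    by rewrite !nnegrE powR1 ltNge x1 => /(_ ler01 x0).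
  apply: le_lt_trans xi; rewrite -[leLHS](congr1 (@^~ q) (powR1 R)).
  by apply: ge0_ler_powR; rewrite ?nnegrE ?(ltW q0)//; lra.
have tau1' : tau < 1 by apply: lt_trans tau1 _; rewrite invf_lt1// ltr1n.
apply: le_trans (hausdorff_subset _ _ _ AF) _.
apply: le_trans (outer_measure_subadditive
  (H : {outer_measure set 'rV[R]_n -> \bar R}) F n) _.
have c0 := tail_constant; rewrite -/tau in c0.
set c := 5 * _ * _ in c0.
apply: (@le_trans _ _ (\sum_(j < n) c%:E * H Delta)%E).
  apply: lee_sum => j _; apply: le_trans (coord_tail tau j tau0 tau1' tau_n).
  by apply: hausdorff_subset => x [i /val_inj ->].
rewrite -ge0_sume_distrl; last first.
  by move=> _ _; rewrite lee_fin !mulr_ge0 ?expR_ge0 ?powR_ge0.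
apply: lee_wpmul2r; first exact: hausdorff_ge0.
by rewrite sumEFin lee_fin sumr_const card_ord -(mulr_natl c).
Qed.

End sphere_max_tail.

(** * From the tail to the mean of the maximum *)

Lemma open_coord_gt {R : realType} {n : nat} (e : R) :
  open [set x : 'rV[R]_n | exists i, e < x 0 i].
Proof.
have -> : [set x : 'rV[R]_n | exists i, e < x 0 i] =
    \bigcup_(i in [set: 'I_n]) [set x | e < x 0 i].
  by apply/seteqP; split=> [x [i xi]|x [i _ xi]]; exists i.
apply: bigcup_open => i _; apply: (@open_comp _ _ (fun x : 'rV[R]_n => x 0 i) [set t | e < t]).
  by move=> x _; exact: coord_continuous.
exact: open_gt.
Qed.

Lemma lq_norm_pinfty_le {R : realType} {n : nat} {p : R} (e : R) (x : 'rV[R]_n) :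
  0 < p -> 0 <= e -> pos_lp_sphere n p x ->
  lq_norm +oo%E x <= e + \1_[set x | exists i, e < x 0 i] x.
Proof.
move=> p0 e0 Dx; have x0 i : 0 <= x 0 i by case: Dx.
rewrite indicE /=; apply: bigmax_le => [|i _]; first by rewrite addr_ge0.
rewrite ger0_norm//; have [xe|ex] := leP (x 0 i) e.
  by rewrite (le_trans xe)// lerDl.
rewrite mem_set; last by exists i.
suff : x 0 i <= 1 by move=> /le_trans; apply; rewrite lerDr.
rewrite leNgt; apply/negP => /(gt0_ltr_powR p0).
rewrite !nnegrE powR1 ltNge pos_lp_sphere_powR_le1// => /(_ ler01 (x0 i)).
by [].
Qed.

Local Close Scope classical_set_scope.

Theorem theorem12 (R : realType) (p : R) (hp : 0 < p) :
  exists C : R, 0 < C /\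
    forall n : nat, (2 <= n)%N ->
      (avg_best_approx_error 0 p +oo%E (surface_measure n p)
        <= (C * (ln n.+1%:R / n%:R) `^ p^-1)%:E)%E.
Proof.
pose K := 6 * p + 4; pose c := 5 * expR (expR (2 * p^-1) / 2) * 2 `^ p^-1.
have K0 : 0 < K by rewrite /K; lra.
(* The first summand comes from the threshold [e], the second from the probability of exceeding
   it. *)
exists ((2 * K) `^ p^-1 + c); split.
  by rewrite addr_gt0 ?powR_gt0 ?mulr_gt0 ?expR_gt0.
move=> n n2; set l := ln n.+1%:R / n%:R.
have l0 : 0 <= l by rewrite divr_ge0// ln_ge0// ler1n.
pose e := (2 * (K * ln n.+1%:R / n%:R)) `^ p^-1.
have e0 : 0 <= e by exact: powR_ge0.
pose A := [set x : 'rV[R]_n | exists i, e < x 0 i]%classic.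
apply: le_trans (avg_best_approx_error0_le +oo%E e A e0 _ _) _.
- by apply: sub_sigma_algebra; exact: open_coord_gt.
- by move=> x; exact: lq_norm_pinfty_le.
rewrite mulrDl EFinD; apply: leeD; last exact: sphere_max_tail.
suff -> : e = (2 * K) `^ p^-1 * l `^ p^-1 by [].
by rewrite -powRM // ?mulr_ge0 ?(ltW K0)// /e /l; congr powR; ring.
Qed.
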